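(* Let $t \geq 5$ be an integer. If $G$ is a connected graph on $n$ vertices satisfying $\sigma_2(G) > \frac{t-3}{t-2}n$, then $G$ has either a Hamiltonian path or an induced subgraph isomorphic to $K_{1,t}$.
   Context: All graphs are finite and simple. A Hamiltonian path of $G$ is a path containing all vertices of $G$. For a graph $G$, $\sigma_2(G)$ denotes the minimum of $\deg(x)+\deg(y)$ over all pairs of distinct nonadjacent vertices $x,y$ of $G$. $K_{1,t}$ denotes the star with one center vertex adjacent to $t$ pairwise nonadjacent leaves. *)

(* Defs.v *)
From mathcomp Require Import all_boot.
Set Implicit Arguments. Unset Strict Implicit. Unset Printing Implicit Defensive.

Definition simple_graph (T : finType) (e : rel T) : Prop :=
  symmetric e /\ irreflexive e.

Definition deg (T : finType) (e : rel T) (x : T) : nat := #|[set y | e x y]|.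

Definition connected_graph (T : finType) (e : rel T) : Prop :=
  forall x y : T, connect e x y.

Definition hamiltonian_path (T : finType) (e : rel T) (s : seq T) : Prop :=
  [/\ uniq s, forall v : T, v \in s &
      match s with [::] => True | x :: s' => path e x s' end].

Definition has_induced_star (T : finType) (e : rel T) (t : nat) : Prop :=
  exists (c : T) (L : {set T}),
    [/\ #|L| = t, c \notin L, forall l, l \in L -> e c l &
        forall l1 l2, l1 \in L -> l2 \in L -> l1 != l2 -> ~~ e l1 l2].

(* sigma_2(G) > (t-3)/(t-2) * n, cleared of denominators (t >= 5 so t-2 > 0).
   For a complete graph sigma_2 is a minimum over the empty set (+infinity),
   so the condition holds vacuously, as in this universally quantified form. *)
Definition sigma2_gt (T : finType) (e : rel T) (t : nat) : Prop :=
  forall x y : T, x != y -> ~~ e x y ->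
    (t - 3) * #|T| < (t - 2) * (deg e x + deg e y).

(* Main.v *)
(** Let [s] be a longest path, [w] a vertex off [s], [n] the order of the graph, and
    suppose that there is no induced star with [t] leaves. The ends of [s] are
    nonadjacent and their degrees sum to less than [size s]; with the degree
    condition this forces [w] to have at least [t - 2] neighbours on [s]. Let [X]
    consist of the first vertex of [s] and of the successors of the neighbours of
    [w], and let [k] be its size. Then [X] and [w] form an independent set.

    Count [sum_(x in X) deg x + 2 deg w] as the sum over all vertices [v] of
    [f v := #|F v| + 2 * (w ~ v)], where [F v] is the set of neighbours of [v] in
    [X]. The degree condition makes it larger than [al * n] for
    [al := (k + 2)(t - 3) / (2(t - 2))]. For the opposite bound, cut [s] after each
    neighbour of [w]. Ordering [X] cyclically, starting just after the current
    segment, the sets [F v] descend along the segment (a staircase), since otherwise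
    [s] could be rerouted through [w] into a longer path; absence of the star bounds
    each [#|F v|] by [t - 1], and by [t - 2] next to [w]. These two facts bound the
    sum over a segment [S] by [al * #|S| + 2 al / (k - 1)], and by [al * (#|S| - 1)]
    for the last one; a vertex off [s] has [f v <= 2 <= al], and [f w = 0]. Summing
    up gives at most [al * n]. All these inequalities are stated multiplied by
    [N := 2(t - 2)(k - 1)]. *)
Require Import Defs.
From mathcomp Require Import all_boot.
From mathcomp Require Import zify.
Set Implicit Arguments. Unset Strict Implicit. Unset Printing Implicit Defensive.


(** * Sums of cardinalities along descending families of sets *)

Section Staircase.
Variables (T : finType) (V : Type) (X : {set T}) (ord : T -> nat) (F : V -> {set T}).
Hypothesis ord_inj : {in X &, injective ord}.
Hypothesis FX : forall v, F v \subset X.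

(** For empty [A] this is all of [X], so [stair u v] imposes nothing after an empty [F u]: a new run
    may start there. *)
Definition below (A : {set T}) : {set T} :=
  [set x in X | [forall y in A, ord x <= ord y]].

Definition stair (u v : V) : bool := F v \subset below (F u).

Lemma below_gt0 (A : {set T}) : A \subset X -> A != set0 -> 0 < #|below A|.
Proof.
move=> AX /set0Pn[x0 x0A]; apply/card_gt0P.
have [x xA xmin] := arg_minnP ord x0A.
exists x; rewrite inE (subsetP AX _ xA) /=; apply/forall_inP => y; exact: xmin.
Qed.

(** [A] and [below A] can share only the least element of [A]. *)
Lemma card_below (A B : {set T}) :
  A \subset X -> A \subset B -> below A \subset B -> #|A| + #|below A| <= #|B| + 1.
Proof.
move=> AX AB bAB; rewrite -cardsUI; apply: leq_add.
  by rewrite subset_leq_card // subUset AB.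
apply/card_le1_eqP => x y /setIP[xA].
rewrite inE => /andP[xX /forall_inP xm] /setIP[yA].
rewrite inE => /andP[yX /forall_inP ym].
by apply: ord_inj => //; apply/eqP; rewrite eqn_leq ym // xm.
Qed.

Lemma below_mono (A B : {set T}) :
  A \subset below B -> A != set0 -> below A \subset below B.
Proof.
move=> AB /set0Pn[z zA]; apply/subsetP => x; rewrite !inE.
case/andP=> -> /forall_inP xA /=; apply/forall_inP => y yB.
apply: leq_trans (xA z zA) _.
by move/subsetP: AB => /(_ z zA); rewrite inE => /andP[_ /forall_inP]; apply.
Qed.

(* Along a run of [r] vertices with nonempty [F], the staircase condition bounds
   the sum of the [#|F v|] by [k + r - 1], which beats the average weight [al / N]
   when [r >= 3]; shorter runs also need the bounds [m], and [c] at the end of the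
   list, where the extra weight [g] and the error [d] are allowed. *)
Variables (m k c g N al d : nat).
Hypothesis Xk : #|X| = k.
Hypothesis Fm : forall v, #|F v| <= m.
Hypotheses (H1 : g * N <= al) (H2 : m * N <= 2 * al) (H3 : (c + g) * N <= 2 * al + d).
Hypotheses (H4 : k.+1 * N <= 3 * al) (H5 : (k.+2 + g) * N <= 4 * al).
Hypothesis H6 : (k.+1 + g) * N <= 3 * al + d \/ (m + c + g) * N <= 3 * al + d.
Hypotheses (H7 : d <= g * N) (H8 : N <= al).

Let S l := \sum_(v <- l) #|F v|.

(** The two claims call each other. In the second, which starts inside a run, [below (F u)] is a
    budget: a further nonempty [F v] costs [#|F v| - 1] of it, and the missing 1 is paid by
    [N <= al]. When an empty set ends the run, the first claim takes over and [d <= g * N] absorbs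
    its error. *)
Lemma staircase_sum_aux n l : size l <= n -> sorted stair l ->
  (forall v l', l = rcons l' v -> #|F v| <= c) ->
  (forall v l', l = v :: l' -> F v = set0 -> (S l + g) * N <= al * size l + d) /\
  (forall u, path stair u l -> F u != set0 ->
     (S l + g + 1) * N <= (#|below (F u)| + g) * N + al * size l).
Proof.
have mulN a b : a <= b -> a * N <= b * N by move=> ab; rewrite leq_mul2r ab orbT.
rewrite /S; elim: n l => [|n IH] l.
  case: l => // _ _ _; split=> // u _ Fu0.
  rewrite big_nil; have := mulN _ _ (below_gt0 (FX u) Fu0); lia.
move=> sl so lc.
(* Cases on the length of the run of nonempty sets after [v]: 0, 1, 2 or at least 3. Each short run
   stops at the end of the list or at a new empty set; from the third set on, the second claim
   applies. *)
have E : forall v l', l = v :: l' -> F v = set0 -> (S l + g) * N <= al * size l + d.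
  move=> v l' El Fv; subst l; rewrite /S big_cons Fv cards0 add0n /=.
  have so' : sorted stair l' := path_sorted so.
  have lc' : forall v l'', l' = rcons l'' v -> #|F v| <= c.
    by move=> u l'' El; apply: (lc u (v :: l'')); rewrite El.
  move: sl so' lc'; clear so lc; rewrite /=; case: l' => [|v1 l1] sl so1 lc1.
    by rewrite big_nil /=; lia.
  have [F1|F1] := eqVneq (F v1) set0.
    have [/(_ v1 l1 erefl F1) + _] := IH (v1 :: l1) sl so1 lc1.
    by rewrite /=; lia.
  rewrite big_cons /=.
  have lc2 : forall v l'', l1 = rcons l'' v -> #|F v| <= c.
    by move=> u l'' El; apply: (lc1 u (v1 :: l'')); rewrite El.
  case: l1 lc2 sl so1 lc1 => [|v2 l2] lc2 sl so1 lc1.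
    rewrite big_nil /=; have := mulN _ _ (lc1 v1 [::] erefl); lia.
  have so2 : sorted stair (v2 :: l2) := path_sorted so1.
  have sl2 : size (v2 :: l2) <= n := ltnW sl.
  have [F2|F2] := eqVneq (F v2) set0.
    have [/(_ v2 l2 erefl F2) + _] := IH (v2 :: l2) sl2 so2 lc2.
    by have := mulN _ _ (Fm v1); rewrite /=; lia.
  have st12 : F v2 \subset below (F v1) by case/andP: so1.
  have b1 : #|F v1| + #|below (F v1)| <= k + 1.
    rewrite -Xk; apply: card_below => //; apply/subsetP => x; rewrite inE.
    by case/andP.
  have b2 := card_below (FX v2) st12 (below_mono st12 F2).
  have p2 := below_gt0 (FX v2) F2.
  rewrite big_cons /=.
  have lc3 : forall v l'', l2 = rcons l'' v -> #|F v| <= c.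
    by move=> u l'' El; apply: (lc2 u (v2 :: l'')); rewrite El.
  have f12 : #|F v1| + #|F v2| <= k.+1 by lia.
  move: sl so1 lc1 => _ _ _.
  case: l2 lc3 sl2 so2 lc2 => [|v3 l3] lc3 sl2 so2 lc2.
    have f12' := leq_add (Fm v1) (lc2 v2 [::] erefl).
    by rewrite big_nil /=; have := mulN _ _ f12; have := mulN _ _ f12'; lia.
  have so3 : sorted stair (v3 :: l3) := path_sorted so2.
  have sl3 : size (v3 :: l3) <= n := ltnW sl2.
  have [F3|F3] := eqVneq (F v3) set0.
    have [/(_ v3 l3 erefl F3) + _] := IH (v3 :: l3) sl3 so3 lc3.
    by have := mulN _ _ f12; rewrite /=; lia.
  have st23 : F v3 \subset below (F v2) by case/andP: so2.
  have b3 := card_below (FX v3) st23 (below_mono st23 F3).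
  have lc4 : forall v l'', l3 = rcons l'' v -> #|F v| <= c.
    by move=> u l'' El; apply: (lc3 u (v3 :: l'')); rewrite El.
  have [_ /(_ v3 so3 F3)] := IH l3 (ltnW sl3) (path_sorted so3) lc4.
  rewrite big_cons /=.
  have q1 : #|F v1| + #|F v2| + #|F v3| + #|below (F v3)| <= k + 3 by lia.
  by have := mulN _ _ q1; lia.
split=> // u pu Fu.
have p0 := mulN _ _ (below_gt0 (FX u) Fu).
case: l sl so lc E pu => [|v l] sl so lc E pu; first by rewrite big_nil /=; lia.
have [Fv|Fv] := eqVneq (F v) set0; first by have := E v l erefl Fv; rewrite /S; lia.
have stuv : F v \subset below (F u) by case/andP: pu.
have b := card_below (FX v) stuv (below_mono stuv Fv).
have lc' : forall v l'', l = rcons l'' v -> #|F v| <= c.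
  by move=> x l'' El; apply: (lc x (v :: l'')); rewrite El.
have [_ /(_ v so Fv)] := IH l sl (path_sorted so) lc'.
by rewrite big_cons /=; have := mulN _ _ b; lia.
Qed.

Lemma staircase_sum v l : sorted stair (v :: l) -> F v = set0 ->
  #|F (last v l)| <= c ->
  (S (v :: l) + g) * N <= al * size (v :: l) + d.
Proof.
move=> so Fv lc; apply: (proj1 (staircase_sum_aux (leqnn _) so _)) Fv => //.
by move=> u l' /(congr1 (last v)) /=; rewrite last_rcons => <-.
Qed.

End Staircase.


(** * The final segment of the path *)

Section LastSegment.
Variables (T : finType) (V : Type) (X : {set T}) (ord : T -> nat) (F : V -> {set T}).
Hypothesis ord_inj : {in X &, injective ord}.
Hypothesis FX : forall v, F v \subset X.

(** Equivalently, [F v] contains at most the [ord]-greatest element of [X]. *)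
Let top v := X \subset below X ord (F v).

(** Read backwards: if [F u] is nonempty and [top u] holds, then [F u] contains the greatest
    element, so the staircase condition gives [top] for the predecessor. Hence the run stops only at
    an empty set or at the start of [l]. *)
Lemma top_run_split l : sorted (stair X ord F) l ->
  (forall v l', l = rcons l' v -> top v) ->
  exists l1 l2, [/\ l = l1 ++ l2, all top l2 &
    l1 = [::] \/ exists u l3, l2 = u :: l3 /\ F u = set0].
Proof.
elim: l => [|v l IH] so lt; first by exists [::], [::]; split=> //; left.
have {IH}[u l' El|l1 [l2 [El al2 l12]]] := IH (path_sorted so).
  by apply: (lt u (v :: l')); rewrite El.
case: l12 => [l10|l2u]; last first.
  by exists (v :: l1), l2; split=> //; [rewrite El | right].
move: El; rewrite l10 /= => El; subst l1 l2.
case: l so lt al2 => [|u l] so lt al2.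
  by exists [::], [:: v]; split; [| rewrite /= (lt v [::]) | left].
have [Fu|Fu] := eqVneq (F u) set0.
  by exists [:: v], (u :: l); split=> //; right; exists u, l.
exists [::], (v :: u :: l); split=> //; last by left.
apply/andP; split=> //; move/set0Pn: Fu => [z zu].
have st : F u \subset below X ord (F v) by case/andP: so.
apply/subsetP => x xX; rewrite inE xX; apply/forall_inP => y yv.
have /andP[/subsetP/(_ x xX) + _] := al2.
rewrite inE => /andP[_ /forall_inP/(_ z zu)]; move/leq_trans; apply.
by move/subsetP: st => /(_ z zu); rewrite inE => /andP[_ /forall_inP]; apply.
Qed.

Variables (m k N al : nat).
Hypothesis Xk : #|X| = k.
Hypothesis Fm : forall v, #|F v| <= m.
Hypotheses (H2 : m * N <= 2 * al) (H4 : k.+1 * N <= 3 * al).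
Hypotheses (H5 : k.+2 * N <= 4 * al) (H8 : N <= al).

(** The part before the top run obeys [staircase_sum] with [g = d = 0]. The top run contributes at
    most 1 per vertex and begins with an empty set, which saves one [al]. *)
Lemma last_segment_sum v l : sorted (stair X ord F) (v :: l) -> F v = set0 ->
  top (last v l) ->
  (\sum_(u <- v :: l) #|F u|) * N + al <= al * size (v :: l).
Proof.
move=> so Fv tl.
have [u l'|l1 [l2 [El al2 l12]]] := top_run_split so.
  by move=> /(congr1 (last v)) /=; rewrite last_rcons => <-.
have top1 u : top u -> #|F u| <= 1.
  move=> tu.
  have bX : below X ord (F u) \subset X.
    by apply/subsetP => x; rewrite inE => /andP[].
  have := card_below ord_inj (FX u) (FX u) bX.
  by have := subset_leq_card tu; lia.
have s2 l' : all top l' -> \sum_(u <- l') #|F u| <= size l'.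
  elim: l' => [|u l' IH] /=; first by rewrite big_nil.
  by case/andP=> tu al'; rewrite big_cons; have := IH al'; have := top1 u tu; lia.
have [u [l3 [El2 Fu]]] : exists u l3, l2 = u :: l3 /\ F u = set0.
  by case: l12 => // l10; exists v, l; rewrite El l10.
subst l2; have /s2 t3 : all top l3 by case/andP: al2.
rewrite El big_cat /= big_cons Fu cards0 add0n size_cat /=.
have : (\sum_(i <- l1) #|F i|) * N <= al * size l1.
  case: l1 El {l12} => [|v' l1] El; first by rewrite big_nil.
  have [v'v _] : v = v' /\ True by case: El.
  subst v'.
  have := @staircase_sum _ _ _ _ _ ord_inj FX m k m 0 N al 0 Xk Fm _ _ _ _ _ _ _ _ v l1.
  rewrite !addn0; apply=> //.
  - by left.
  - by have := so; rewrite El => /cat_sorted2[].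
set A := \sum_(i <- l1) _ => q1.
have q3 : (\sum_(j <- l3) #|F j|) * N <= size l3 * N by rewrite leq_mul2r t3 orbT.
have q4 : size l3 * N <= size l3 * al by rewrite leq_mul2l H8 orbT.
lia.
Qed.

End LastSegment.


(** * Splitting lists *)

Lemma has_split (T : Type) (a : pred T) l : has a l ->
  exists p u r, [/\ l = rcons p u ++ r, a u & ~~ has a p].
Proof.
elim: l => // v l IH /=; case: (boolP (a v)) => [av _|nav /= /IH[p [u [r [-> au np]]]]].
  by exists [::], v, l.
by exists (v :: p), u, r; rewrite /= negb_or nav.
Qed.

Lemma sorted_consecutive (T : Type) (r : rel T) l :
  (forall A a b B, l = A ++ a :: b :: B -> r a b) -> sorted r l.
Proof.
elim: l => // a [|b l] IH H //=; rewrite (H [::] a b l) //=.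
by apply: IH => A c d B E; apply: (H (a :: A) c d B); rewrite E.
Qed.

(** * Walks, and the cutting of a longest path at the neighbours of [w] *)

Section LongestPath.
Variables (T : finType) (e : rel T) (s : seq T) (w : T).
Hypotheses (esym : symmetric e) (eirr : irreflexive e).
Hypotheses (us : uniq s) (ss : sorted e s) (ws : w \notin s).
Hypothesis smax : forall s', uniq s' -> sorted e s' -> size s' <= size s.

(** Repetitions are allowed: reroutings are glued by [walk_cat], and distinctness is checked once,
    through the final [perm_eq]. *)
Definition walk (a b : T) (l : seq T) : Prop :=
  [/\ l != [::], sorted e l, head w l = a & last w l = b].

Lemma walkI l : l != [::] -> sorted e l -> walk (head w l) (last w l) l.
Proof. by split. Qed.

Lemma walk1 a : walk a a [:: a].
Proof. by split. Qed.

Lemma walk_cat a b c d l l' : walk a b l -> walk c d l' -> e b c -> walk a d (l ++ l').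
Proof.
case: l => [|x l] [] // _ /= sl <- <-; case: l' => [|y l'] [] // _ /= sl' <- <- ebc.
by split=> //=; rewrite ?cat_path ?last_cat //= sl ebc.
Qed.

Lemma walk_rev a b l : walk a b l -> walk b a (rev l).
Proof.
case=> l0 sl <- <-; split.
- by rewrite -size_eq0 size_rev size_eq0.
- by rewrite rev_sorted (eq_sorted (e' := e)) // => x y; rewrite esym.
- by case/lastP: l l0 {sl} => // l x _; rewrite rev_rcons last_rcons.
- by case: l l0 {sl} => // x l _; rewrite rev_cons last_rcons.
Qed.

Lemma no_longer_path a b y l s' :
  walk a b s' -> perm_eq s' (y :: l ++ s) -> uniq (y :: l ++ s) -> False.
Proof.
case=> _ so _ _ pe un.
have := smax (s' := s'); rewrite (perm_uniq pe) (perm_size pe) un so => /(_ isT isT).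
by rewrite /= size_cat ltnNge leq_addl.
Qed.

Lemma no_path_w a b s' : walk a b s' -> perm_eq s' (w :: s) -> False.
Proof.
move=> wk pe; apply: (no_longer_path (y := w) (l := [::]) wk pe).
by rewrite /= ws.
Qed.

Lemma no_path_wy a b y s' :
  y \notin s -> y != w -> walk a b s' -> perm_eq s' (w :: y :: s) -> False.
Proof.
move=> ys yw wk pe; apply: (no_longer_path (y := w) (l := [:: y]) wk pe).
by rewrite /= inE eq_sym negb_or yw ws ys.
Qed.

Lemma s_neq0 : s != [::].
Proof. by apply/eqP => s0; have := smax (s' := [:: w]) isT isT; rewrite s0. Qed.

(* The elements of [l] preceded by a neighbour of [w]; [b] tells whether the first
   one counts. *)
Fixpoint heads (b : bool) (l : seq T) : seq T :=
  if l is v :: l' then (if b then [:: v] else [::]) ++ heads (e w v) l' else [::].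

(* Whether an element put right after [l] is in [heads b]. *)
Definition cut (b : bool) (l : seq T) : bool :=
  if l is v :: l' then e w (last v l') else b.

Lemma cut_cons b v l : cut (e w v) l = cut b (v :: l).
Proof. by case: l. Qed.

Lemma heads_cat b l1 l2 : heads b (l1 ++ l2) = heads b l1 ++ heads (cut b l1) l2.
Proof. by elim: l1 b => //= v l1 IH b; rewrite IH -catA (cut_cons b). Qed.

Lemma cut_cat b l1 l2 : cut b (l1 ++ l2) = cut (cut b l1) l2.
Proof. by case: l1 l2 => [|x l1] [|y l2] //=; rewrite ?cats0 // last_cat. Qed.

Lemma heads_subseq b l : subseq (heads b l) l.
Proof.
elim: l b => // v l IH [] /=; first by rewrite eqxx.
exact: subseq_trans (IH _) (subseq_cons _ _).
Qed.

Lemma size_heads b v l : ~~ e w (last v l) ->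
  size (heads b (v :: l)) = b + count (e w) (v :: l).
Proof.
elim: l v b => [|u l IH] v b /=; first by case: b => /negbTE->.
by move=> h; rewrite size_cat (IH u) //=; case: b.
Qed.

Lemma heads_seg b v l : all (predC (e w)) (belast v l) ->
  heads b (v :: l) = if b then [:: v] else [::].
Proof.
elim: l v b => [|u l IH] v b /=; first by rewrite cats0.
by case/andP=> /negbTE-> h; have := IH u false h => /= ->; rewrite cats0.
Qed.

Lemma heads_in b l x : x \in heads b l ->
  exists l1 l2, l = l1 ++ x :: l2 /\ cut b l1.
Proof.
elim: l b => // v l IH b /=; rewrite mem_cat => /orP[|/IH[l1 [l2 [-> c1]]]].
  by case: b => //; rewrite inE => /eqP->; exists [::], l.
by exists (v :: l1), l2; rewrite -cut_cons.
Qed.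

Lemma heads_in2 b l x y : index x (heads b l) < index y (heads b l) ->
  y \in heads b l ->
  exists l1 l2 l3, [/\ l = l1 ++ (x :: l2) ++ (y :: l3), cut b l1 & e w (last x l2)].
Proof.
elim: l b => // v l IH b /=.
have tl : index x (heads (e w v) l) < index y (heads (e w v) l) ->
    y \in heads (e w v) l -> exists l1 l2 l3,
    [/\ v :: l = l1 ++ (x :: l2) ++ (y :: l3), cut b l1 & e w (last x l2)].
  move=> lt yin; have [l1 [l2 [l3 [-> c1 c2]]]] := IH _ lt yin.
  by exists (v :: l1), l2, l3; rewrite -cut_cons.
case: b tl => tl /=; last exact: tl.
rewrite inE; have [<-|nvx] := eqVneq v x.
  have [//|nvy _ /=] := eqVneq v y.
  case/heads_in=> l1 [l2 [-> c1]].
  by exists [::], l1, l2; split=> //=; rewrite (cut_cons true) in c1.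
by have [//|nvy] := eqVneq v y; rewrite ltnS /=; apply: tl.
Qed.

(** Allowing an empty [l] spares a separate case for the first vertex of [s]. *)
Lemma walk_cut_w l : cut true l -> sorted e l -> exists a, walk a w (l ++ [:: w]).
Proof.
case: l => [|v l] /=; first by exists w; exact: walk1.
move=> c so; exists v; apply: (@walk_cat v (last v l) w w (v :: l) [:: w]); first by split.
  exact: walk1.
by rewrite esym.
Qed.

(** * Constraints on [X] from the maximality of the path *)

Lemma w_last : ~~ e w (last w s).
Proof.
apply/negP => ew.
apply: (no_path_w (walk_cat (walkI s_neq0 ss) (walk1 w) _)); first by rewrite esym.
by rewrite cats1 perm_rcons.
Qed.

Let X := heads true s.

Lemma X_uniq : uniq X.
Proof. exact: subseq_uniq (heads_subseq _ _) us. Qed.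

Lemma X_sub x : x \in X -> x \in s.
Proof. exact: mem_subseq (heads_subseq _ _) x. Qed.

Lemma size_X : size X = (count (e w) s).+1.
Proof.
rewrite /X; case: s s_neq0 w_last => // v l _ wl.
by rewrite size_heads.
Qed.

Ltac perm_count := apply/permP => ?; do 4! rewrite /= ?(count_cat, count_rev); clear; lia.

Lemma X_w x : x \in X -> ~~ e w x.
Proof.
move=> /heads_in[l1 [l2 [Es c1]]]; apply/negP => ew.
have /cat_sorted2[so1 so2] : sorted e (l1 ++ x :: l2) by rewrite -Es.
have [a wk] := walk_cut_w c1 so1.
apply: (no_path_w (walk_cat wk (walkI (l := x :: l2) isT so2) ew)).
by rewrite Es; perm_count.
Qed.

(** The last vertices of [l1] (if any) and of [x :: l2] are neighbours of [w], so [w] can follow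
    [l1] and the stretch from [x] be reversed. The two walks cover [s] and [w]; linking [x] to an
    end of the second one yields a longer path. *)
Lemma X_before x y : index x X < index y X -> y \in X ->
  exists l1 l2 l3 a, [/\ s = l1 ++ (x :: l2) ++ (y :: l3),
    walk a x ((l1 ++ [:: w]) ++ rev (x :: l2)) & walk y (last w s) (y :: l3)].
Proof.
move=> lt yX; have [l1 [l2 [l3 [Es c1 c2]]]] := heads_in2 lt yX.
have /cat_sorted2[so1 /cat_sorted2[so2 so3]] :
  sorted e (l1 ++ (x :: l2) ++ (y :: l3)) by rewrite -Es.
have [a wk] := walk_cut_w c1 so1.
exists l1, l2, l3, a; split=> //.
  exact: (walk_cat wk (walk_rev (walkI (l := x :: l2) isT so2)) c2).
by split=> //; rewrite Es !last_cat.
Qed.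

Lemma X_indep x y : x \in X -> y \in X -> ~~ e x y.
Proof.
have H u v : index u X < index v X -> v \in X -> ~~ e u v.
  move=> lt vX; apply/negP => euv.
  have [l1 [l2 [l3 [a [Es w1 w2]]]]] := X_before lt vX.
  by apply: (no_path_w (walk_cat w1 w2 euv)); rewrite Es; perm_count.
move=> xX yX; case: (ltngtP (index x X) (index y X)) => [lt|lt|eq].
- exact: H.
- by rewrite esym; exact: H.
- by rewrite (index_inj x xX yX eq) eirr.
Qed.

Lemma X_last x y : index x X < index y X -> y \in X -> ~~ e (last w s) x.
Proof.
move=> lt yX; apply/negP => el.
have [l1 [l2 [l3 [a [Es w1 w2]]]]] := X_before lt yX.
apply: (no_path_w (walk_cat w1 (walk_rev w2) _)); first by rewrite esym.
by rewrite Es; perm_count.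
Qed.

Lemma X_off y x x' : y \notin s -> y != w -> x \in X -> x' \in X ->
  e y x -> e y x' -> x = x'.
Proof.
move=> ys yw.
have H u v : index u X < index v X -> v \in X -> e y u -> e y v -> False.
  move=> lt vX eu ev.
  have [l1 [l2 [l3 [a [Es w1 w2]]]]] := X_before lt vX.
  apply: (no_path_wy ys yw (walk_cat w1 (walk_cat (walk1 y) w2 ev) _)).
    by rewrite esym.
  by rewrite Es; perm_count.
move=> xX xX' ex ex'; case: (ltngtP (index x X) (index x' X)) => [lt|lt|eq].
- by case: (H x x').
- by case: (H x' x).
- exact: (index_inj x xX xX' eq).
Qed.

(** Otherwise [w] and [y] could both be inserted in front of [x]. *)
Lemma X_off_w y x : y \notin s -> e w y -> x \in X -> ~~ e y x.
Proof.
move=> ys ewy /heads_in[l1 [l2 [Es c1]]]; apply/negP => eyx.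
have yw : y != w by apply/eqP => yw; rewrite yw eirr in ewy.
have /cat_sorted2[so1 so2] : sorted e (l1 ++ x :: l2) by rewrite -Es.
have [a wk] := walk_cut_w c1 so1.
apply: (no_path_wy ys yw (walk_cat wk (walk_cat (walk1 y) (walkI (l := x :: l2) isT so2) eyx) ewy)).
by rewrite Es; perm_count.
Qed.

(* Read cyclically from the head of [R], the neighbours in [X] of the head of [R]
   may not come after those of the last vertex of [L]: otherwise the path can be
   rerouted through [w]. *)
Lemma X_cross L R x y : s = L ++ R -> L != [::] -> R != [::] ->
  let Y := heads false R ++ heads true L in
  y \in Y -> index x Y < index y Y -> e (last w L) x -> e (head w R) y -> False.
Proof.
move=> Es L0 R0 Y yY lt ex ey.
have /cat_sorted2[soL soR] : sorted e (L ++ R) by rewrite -Es.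
have wL := walkI L0 soL; have wR := walkI R0 soR.
have cutN r : cut false r -> r != [::] /\ e (last w r) w.
  by case: r => // v r /=; rewrite esym.
move: yY lt; rewrite /Y !index_cat mem_cat.
case: (boolP (x \in heads false R)) => xR; case: (boolP (y \in heads false R)) => yR /=.
(* Both in [R]: the longer path is [L], [x :: l2], [w], [rev l1], [y :: l3]. *)
- move=> _ lt; have [l1 [l2 [l3 [ER /cutN[l10 c1] c2]]]] := heads_in2 lt yR.
  have /cat_sorted2[so1 /cat_sorted2[so2 so3]] :
    sorted e (l1 ++ (x :: l2) ++ (y :: l3)) by rewrite -ER.
  have hR : head w R = head w l1 by rewrite ER; case: (l1) l10.
  have w3 := walkI (isT : y :: l3 != [::]) so3.
  have w1 := walk_rev (walkI l10 so1).
  rewrite -hR in w1.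
  have w2 := walkI (isT : x :: l2 != [::]) so2.
  have wk := walk_cat wL (walk_cat w2 (walk_cat (walk1 w) (walk_cat w1 w3 ey) _) _) ex.
  apply: (no_path_w (wk _ _)); rewrite 1?esym //=.
  by rewrite Es ER; perm_count.
(* Here [x] is in [R] and [y] in [L]: take [l1], [w], [rev r1], [y :: l2], [x :: r2]. *)
- move=> yL _; have [l1 [l2 [EL c1]]] := heads_in yL.
  have [r1 [r2 [ER /cutN[r10 d1]]]] := heads_in xR.
  have /cat_sorted2[so1 so2] : sorted e (l1 ++ y :: l2) by rewrite -EL.
  have /cat_sorted2[to1 to2] : sorted e (r1 ++ x :: r2) by rewrite -ER.
  have hR : head w R = head w r1 by rewrite ER; case: (r1) r10.
  have hL : last w L = last w (y :: l2) by rewrite EL last_cat.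
  have [a w1] := walk_cut_w c1 so1.
  have w2 := walk_rev (walkI r10 to1).
  have w3 := walkI (isT : y :: l2 != [::]) so2.
  have w4 := walkI (isT : x :: r2 != [::]) to2.
  rewrite hL in ex; rewrite hR in ey.
  have wk := walk_cat w1 (walk_cat w2 (walk_cat w3 w4 ex) ey).
  apply: (no_path_w (wk _)); first by rewrite esym.
  by rewrite Es EL ER; perm_count.
- by move=> _; rewrite ltnNge (leq_trans (index_size _ _)) // leq_addr.
(* Both in [L]: take [l1], [w], [rev (x :: l2)], [rev (y :: l3)], [R]. *)
- move=> yL; rewrite ltn_add2l => lt.
  have [l1 [l2 [l3 [EL c1 c2]]]] := heads_in2 lt yL.
  have /cat_sorted2[so1 /cat_sorted2[so2 so3]] :
    sorted e (l1 ++ (x :: l2) ++ (y :: l3)) by rewrite -EL.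
  have [a w1] := walk_cut_w c1 so1.
  have w2 := walk_rev (walkI (isT : x :: l2 != [::]) so2).
  have w3 := walk_rev (walkI (isT : y :: l3 != [::]) so3).
  have hL : last w L = last w (y :: l3) by rewrite EL !last_cat.
  rewrite hL in ex; rewrite esym in ey.
  rewrite esym in ex.
  have wk := walk_cat w1 (walk_cat w2 (walk_cat w3 wR ey) ex) c2.
  apply: (no_path_w wk).
  by rewrite Es EL; perm_count.
Qed.

(** * Degrees of the ends of the path and of [w], using connectivity *)

Lemma path_leaves (A : {pred T}) x p : path e x p -> x \in A -> last x p \notin A ->
  exists a b, [/\ a \in A, b \notin A & e a b].
Proof.
elim: p x => [|y p IH] x /=; first by move=> _ ->.
case/andP=> exy py xA lA; case: (boolP (y \in A)) => yA; first exact: (IH y).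
by exists x, y.
Qed.

Lemma count_shift (P Q : pred T) h l :
  (forall A a b B, h :: l = A ++ a :: b :: B -> P b -> Q a -> False) ->
  count P l + count Q (belast h l) <= size l.
Proof.
elim: l h => // b l IH h H /=.
have := IH b (fun A a c B E => H (h :: A) a c B (congr1 (cons h) E)).
have := H [::] h b l erefl.
by case: (P b); case: (Q h) => // Hab; [case: Hab | |..]; lia.
Qed.

Hypothesis econn : connected_graph e.

(** By connectivity some [z] on the cycle has a neighbour [y] off [s]; opening the cycle at [z] and
    starting from [y] gives a longer path. *)
Lemma no_cycle a b c : walk a b c -> e b a -> perm_eq c s -> False.
Proof.
move=> wc eba pc.
have /connectP[p pp lp] := econn (head w s) w.
have hs : head w s \in s by case: (s) s_neq0 => // x l _; rewrite inE eqxx.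
have [|z [y [zs ys ezy]]] := path_leaves pp hs; first by rewrite -lp.
have zc : z \in c by rewrite (perm_mem pc).
have Ec := cat_take_drop (index z c) c; move: Ec.
rewrite (drop_index zc); set A := take _ _; set B := drop _ _ => Ec.
case: wc => _ sc hc lc; rewrite -Ec in sc hc lc pc.
have /cat_sorted2[sA sB] := sc.
have wB := walkI (isT : z :: B != [::]) sB.
have lB : last w (z :: B) = b by rewrite -lc last_cat.
rewrite lB in wB; rewrite esym in ezy.
have wy := walk_cat (walk1 y) wB ezy.
have un : uniq (y :: [::] ++ s) by rewrite /= ys.
case EA: A => [|v A'].
  rewrite EA in pc; apply: (no_longer_path wy _ un).
  by rewrite /= perm_cons.
have A0 : A != [::] by rewrite EA.
have hA : head w A = a by rewrite -hc EA.
have wA := walkI A0 sA; rewrite hA in wA.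
apply: (no_longer_path (walk_cat wy wA eba) _ un).
by rewrite /= perm_cons -cat_cons perm_catC.
Qed.

Lemma ends_nonadjacent : ~~ e (last w s) (head w s).
Proof. by apply/negP => el; apply: (no_cycle (walkI s_neq0 ss) el). Qed.

Lemma ends_neq : head w s != last w s.
Proof.
apply/eqP => hl; case Es: s => [|x [|y l]]; first by have := s_neq0; rewrite Es.
  have /connectP[p pp lp] := econn x w.
  have xs : x \in s by rewrite Es inE.
  have [|z [y [zs ys ezy]]] := path_leaves pp xs; first by rewrite -lp.
  have := zs; rewrite Es inE => /eqP zx.
  have := smax (s' := [:: x; y]); rewrite Es /= inE -zx ezy.
  have -> : z != y by apply: contraNneq ys => <-.
  by move/(_ isT isT).
by move: us hl; rewrite Es /= inE => /andP[+ _]; move=> + xl; rewrite xl -in_cons mem_last.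
Qed.

Lemma end_off y : y \notin s -> ~~ e (head w s) y /\ ~~ e (last w s) y.
Proof.
move=> ys; have wk := walkI s_neq0 ss.
have un : uniq (y :: [::] ++ s) by rewrite /= ys.
split; apply/negP => ey.
  rewrite esym in ey.
  by apply: (no_longer_path (walk_cat (walk1 y) wk ey) _ un).
apply: (no_longer_path (walk_cat wk (walk1 y) ey) _ un).
by rewrite cats1 perm_rcons.
Qed.

Lemma degE x : deg e x = \sum_y (e x y : nat).
Proof.
rewrite /deg cardsE -sum1_card big_mkcond; apply: eq_bigr => y _.
by rewrite -topredE /=; case: (e x y).
Qed.

Lemma deg_split x : deg e x = count (e x) s + \sum_(y | y \notin s) (e x y : nat).
Proof.
rewrite degE (bigID (mem s)) /= -big_uniq //=; congr addn.
by elim: (s) => [|y l IH]; rewrite ?big_nil // big_cons IH.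
Qed.

(** Ore's crossing argument: the ends have all their neighbours on [s]. If [a], [b] are consecutive,
    the first vertex adjacent to [b] and the last one to [a], then reversing the part from [b] on
    closes a cycle. *)
Lemma deg_ends : deg e (head w s) + deg e (last w s) < size s.
Proof.
rewrite !deg_split !big1 ?addn0.
- case Es: s => [|h l]; first by have := s_neq0; rewrite Es.
  rewrite /= eirr add0n.
  rewrite -[e (last h l) h + _]/(count (e (last h l)) (h :: l)).
  rewrite lastI -cats1 count_cat /= eirr !addn0 ltnS.
  apply: count_shift => A a b B E ehb ela.
  have E' : s = rcons A a ++ b :: B by rewrite cat_rcons -E.
  have /cat_sorted2[sA sB] : sorted e (rcons A a ++ b :: B) by rewrite -E'.
  have A0 : rcons A a != [::] by case: (A).
  have wA := walkI A0 sA; have wB := walk_rev (walkI (isT : b :: B != [::]) sB).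
  have hA : head w (rcons A a) = h.
    by have := congr1 (head w) E'; rewrite Es; case: (A) => [|? ?] /= ->.
  have lB : last w (b :: B) = last h l.
    by have := congr1 (last w) E'; rewrite Es last_cat.
  rewrite hA last_rcons in wA; rewrite lB in wB; rewrite esym in ela.
  apply: (no_cycle (walk_cat wA wB ela)); first by rewrite esym.
  by rewrite E' perm_cat2l perm_rev.
- by move=> y /end_off[_ /negbTE->].
- by move=> y /end_off[/negbTE->].
Qed.

Lemma size_s_lt : size s < #|T|.
Proof.
rewrite -(card_uniqP us); apply: proper_card; apply/properP.
by split; [apply/subsetP | exists w].
Qed.

Lemma card_off : #|[pred x | (x \notin s) & (x != w)]| = (#|T| - size s).-1.
Proof.
have := cardC (mem s); rewrite (card_uniqP us).
rewrite (cardD1 w [predC mem s]) inE /= ws => <-.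
have -> : #|[pred x | (x \notin s) & (x != w)]| = #|[predD1 [predC s] & w]|.
  by apply: eq_card => x; rewrite !inE andbC.
by rewrite addKn add1n.
Qed.

Lemma deg_w : deg e w <= count (e w) s + (#|T| - size s).-1.
Proof.
rewrite deg_split leq_add2l (bigD1 w) //= eirr add0n.
apply: (@leq_trans (\sum_(y | (y \notin s) && (y != w)) 1)).
  by apply: leq_sum => y _; case: e.
by rewrite sum1_card card_off.
Qed.

(** The condition for the two ends, with [deg_ends], makes the path long. If [w] had fewer
    neighbours on it, the conditions for [w] with each end would make it too short. *)
Lemma count_w_ge t : 5 <= t -> sigma2_gt e t -> t - 2 <= count (e w) s.
Proof.
move=> t5 sig.
have [h1 h2] := end_off ws.
have nh : head w s != w by apply: contraNneq ws => <-; case: (s) s_neq0 => // x l _; rewrite inE eqxx.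
have nl : last w s != w by apply: contraNneq ws => <-; case: (s) s_neq0 => // x l _ /=; rewrite mem_last.
have s1 := sig _ _ nh h1; have s2 := sig _ _ nl h2.
have s3 : (t - 3) * #|T| < (t - 2) * (deg e (head w s) + deg e (last w s)).
  by apply: sig ends_neq _; rewrite esym ends_nonadjacent.
move: s1 s2 s3 deg_ends deg_w size_s_lt t5.
move: (deg e _) (deg e _) (deg e _) (count _ _) (size s) #|T|; clear.
move=> dh dw dl c p n s1 s2 s3 h1 h2 h3 t5; rewrite leqNgt; apply/negP => ct.
have [j tj] : exists j, t = j + 5 by exists (t - 5); lia.
subst t; have E3 : j + 5 - 3 = j + 2 by lia.
have E2 : j + 5 - 2 = j + 3 by lia.
rewrite E3 E2 in s1 s2 s3 ct.
have [r pr] : exists r, n = p + r + 1 by exists (n - p - 1); lia.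
have {}h2 : dw <= j + 2 + r by lia.
subst n.
have q1 : (j + 3) * (dh + dl) <= (j + 3) * p.-1 by rewrite leq_mul2l; lia.
have q2 : (j + 3) * dw <= (j + 3) * (j + 2 + r) by rewrite leq_mul2l; lia.
have q3 : (j + 3) * (p.-1 + 1) = (j + 3) * p by congr muln; lia.
have q4 : 2 * j + 7 <= p + r + 1 by lia.
have q5 : j * (2 * j + 7) <= j * (p + r + 1) by rewrite leq_mul2l q4 orbT.
lia.
Qed.

(** * Segments between neighbours of [w] *)

Lemma belast_split (h b : T) q L B : h :: q = L ++ b :: B -> belast h q = L ++ belast b B.
Proof.
case: L => [[-> ->] //|h' L [<- ->]].
by rewrite belast_cat /= -cat_rcons -lastI.
Qed.

Let Xs : {set T} := [set x in X].
Let F v : {set T} := [set x in Xs | e v x].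

Lemma F_sub v : F v \subset Xs.
Proof. by apply/subsetP => x; rewrite inE => /andP[]. Qed.

Lemma card_Xs : #|Xs| = (count (e w) s).+1.
Proof. by rewrite -size_X cardsE; apply/card_uniqP; exact: X_uniq. Qed.

Lemma F_X h : h \in X -> F h = set0.
Proof.
move=> hX; apply/setP => x; rewrite !inE; apply/negP => /andP[xX].
by apply/negP; exact: X_indep.
Qed.

Section Segment.
Variables (s1 s3 q : seq T) (h : T).
Hypotheses (Es : s = s1 ++ (h :: q) ++ s3) (c1 : cut true s1).
Hypothesis nq : all (predC (e w)) (belast h q).
Hypothesis lq : s3 = [::] \/ e w (last h q).

(** The cyclic order of [X] starting just after the segment, whose own head [h] thus comes last. *)
Let Y := heads true s3 ++ heads true s1 ++ [:: h].
Let ord z := index z Y.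

Lemma X_seg : X = heads true s1 ++ h :: heads true s3.
Proof.
rewrite /X Es heads_cat c1 heads_cat heads_seg //=.
by case: lq => [-> //|/= ->].
Qed.

Lemma mem_Y : Y =i X.
Proof. by move=> x; rewrite X_seg /Y !(mem_cat, inE); do !case: (_ \in _); rewrite ?orbT ?orbF. Qed.

Lemma ord_inj : {in Xs &, injective ord}.
Proof.
move=> x y; rewrite !inE -!mem_Y => xY yY; exact: (index_inj x xY yY).
Qed.

Lemma head_in_X : h \in X.
Proof. by rewrite X_seg mem_cat inE eqxx orbT. Qed.

(** [X_cross] is applied to the cut between consecutive [a] and [b]. Since [a] is no neighbour of
    [w], the order used there is [Y] for every cut inside the segment. *)
Lemma seg_stair : sorted (stair Xs ord F) (h :: q).
Proof.
apply: sorted_consecutive => A a b B E.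
have E' : h :: q = rcons A a ++ b :: B by rewrite cat_rcons.
move: nq; rewrite (belast_split E') all_cat => /andP[nA nB].
have [A' EA] : exists A', rcons A a = h :: A'.
  by case: A E {E' nA} => [|h' A] [<- _]; [exists [::] | exists (rcons A a)].
apply/subsetP => y; rewrite !inE => /andP[yX eby]; rewrite yX /=.
apply/forall_inP => x; rewrite !inE => /andP[xX eax].
rewrite leqNgt; apply/negP => lt.
have hL : heads true (s1 ++ rcons A a) = heads true s1 ++ [:: h].
  rewrite heads_cat c1 EA heads_seg //.
  by move: nA; rewrite EA lastI all_rcons => /andP[].
have hR : heads false ((b :: B) ++ s3) = heads true s3.
  rewrite heads_cat heads_seg //=.
  case: lq => [-> //|]; have -> : last h q = last b B.
    by have := congr1 (last w) E'; rewrite last_cat.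
  by move=> ->.
apply: (@X_cross (s1 ++ rcons A a) ((b :: B) ++ s3) x y).
- by rewrite Es E' !catA.
- by case: (s1) => [|? ?] //; case: (A).
- by [].
- by rewrite hL hR mem_Y.
- by rewrite hL hR.
- by rewrite last_cat last_rcons.
- by [].
Qed.

End Segment.

(** * Upper bound on the total weight *)

Variables (t k N al de : nat).
Hypothesis Fcap : forall v, #|F v| + e w v < t.
Hypothesis kE : k = (count (e w) s).+1.
Hypotheses (H1 : 2 * N <= al) (H2 : t.-1 * N <= 2 * al) (H3 : t * N <= 2 * al + de).
Hypotheses (H4 : k.+1 * N <= 3 * al) (H5 : k.+4 * N <= 4 * al).
Hypothesis H6 : k.+3 * N <= 3 * al + de \/ (2 * t - 1) * N <= 3 * al + de.
Hypothesis H7 : de <= 2 * N.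
Hypothesis t1 : 1 < t.

Lemma F_cap v : #|F v| <= t.-1.
Proof. by have := Fcap v; clear; lia. Qed.

Lemma F_cap_end u : e w u -> #|F u| <= t - 2.
Proof. by move=> ewu; have := Fcap u; rewrite ewu; clear; lia. Qed.

Lemma N_le_al : N <= al.
Proof. by apply: leq_trans H1; clear; lia. Qed.

Lemma pair_bound :
  (k.+1 + 2) * N <= 3 * al + de \/ (t.-1 + (t - 2) + 2) * N <= 3 * al + de.
Proof.
case: H6 => H; [left; by rewrite addn2 | right].
have <- : 2 * t - 1 = t.-1 + (t - 2) + 2 by move: t1; clear; lia.
by [].
Qed.

(** Segments are peeled off the front. One closed by a neighbour of [w] costs an error [de], its
    extra weight [g = 2] being that of the closing vertex; the final segment saves [al]. *)
Lemma suffix_sum s1 s2 : s = s1 ++ s2 -> cut true s1 -> s2 != [::] ->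
  (\sum_(v <- s2) (#|F v| + 2 * e w v)) * N + al <=
    al * size s2 + de * count (e w) s2.
Proof.
elim: {s2}(size s2).+1 {-2}s2 (ltnSn (size s2)) s1 => // n IH s2 sz s1 Es c1 s20.
case: (boolP (has (e w) s2)) => [|hs2].
  case/has_split=> p [u [s3 [E2 ewu np]]].
  have s30 : s3 != [::].
    apply/eqP => s30; have := w_last; rewrite Es E2 s30 cats0 last_cat last_rcons.
    by rewrite ewu.
  have [h [q Eq]] : exists h q, rcons p u = h :: q.
    by case: (p) => [|h p']; [exists u, [::] | exists h, (rcons p' u)].
  have c3 : cut true (s1 ++ h :: q) by rewrite -Eq cut_cat; case: (p) => [|? ?] //=; rewrite last_rcons.
  have Es' : s = s1 ++ (h :: q) ++ s3 by rewrite Es E2 Eq.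
  have Es3 : s = (s1 ++ (h :: q)) ++ s3 by rewrite Es' catA.
  have sz3 : size s3 < n.
    by rewrite ltnS in sz; apply: leq_trans sz; rewrite E2 size_cat size_rcons addSn ltnS leq_addl.
  have := IH s3 sz3 _ Es3 c3 s30.
  have lq : last h q = u by have := congr1 (last w) Eq; rewrite last_rcons.
  have bq : belast h q = p.
    by have := Eq; rewrite lastI => /rcons_inj[->].
  have nq : all (predC (e w)) (belast h q) by rewrite bq all_predC.
  have lq' : s3 = [::] \/ e w (last h q) by rewrite lq; right.
  have Fh := F_X (head_in_X Es' c1 nq lq').
  have := @staircase_sum _ _ _ _ _ (ord_inj Es' c1 nq lq') F_sub t.-1 k (t - 2) 2 N al de
    _ F_cap H1 H2 _ H4 _ _ H7 _ _ _ (seg_stair Es' c1 nq lq') Fh.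
  rewrite E2 !big_cat count_cat Eq.
  have -> : count (e w) (h :: q) = 1.
    by rewrite -Eq -cats1 count_cat /= ewu; move: np; rewrite has_count -eqn0Ngt => /eqP->.
  have -> : \sum_(i <- h :: q) (#|F i| + 2 * e w i) = \sum_(i <- h :: q) #|F i| + 2.
    rewrite big_split /=; congr addn; rewrite -big_distrr /= -Eq -cats1 big_cat /=.
    rewrite big_seq1 ewu big1_seq // => i /andP[_ ip].
    by apply/eqP; rewrite eqb0; apply: contra np => ei; apply/hasP; exists i.
  rewrite !size_cat; set S1 := \sum_(i <- _ :: _) _; set S2 := \sum_(i <- _) _.
  move=> HS HI.
  have : (S1 + 2) * N <= al * size (h :: q) + de.
    apply: HS; rewrite ?card_Xs //.
    - by rewrite subnK.
    - by rewrite addn2.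
    - exact: pair_bound.
    - exact: N_le_al.
    - by rewrite lq; exact: F_cap_end.
  move: HI; clear HS; move: S1 S2 (size (h :: q)) (size s3) (count (e w) s3).
  by clear=> S1 S2 z z3 c /=; lia.
case: s2 sz Es s20 hs2 => // h q sz Es _ hs2.
have Es' : s = s1 ++ (h :: q) ++ [::] by rewrite cats0.
have nq : all (predC (e w)) (belast h q).
  move: hs2; rewrite -all_predC lastI all_rcons => /andP[_ //].
have lq : [::] = [::] :> seq T \/ e w (last h q) by left.
have Fh := F_X (head_in_X Es' c1 nq lq).
have c0 : count (e w) (h :: q) = 0 by apply/eqP; rewrite eqn0Ngt -has_count.
have -> : \sum_(v <- h :: q) (#|F v| + 2 * e w v) = \sum_(v <- h :: q) #|F v|.
  rewrite big_split /= -big_distrr /= [X in _ + _ * X]big1_seq ?addn0 // => i /andP[_ ip].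
  by apply/eqP; rewrite eqb0; apply: contra hs2 => ei; apply/hasP; exists i.
rewrite c0 muln0 addn0.
apply: (@last_segment_sum _ _ _ _ _ (ord_inj Es' c1 nq lq) F_sub t.-1 k N al _ F_cap H2 H4 _ _
    _ _ (seg_stair Es' c1 nq lq) Fh).
- by rewrite card_Xs.
- by apply: leq_trans H5; rewrite leq_mul2r -(addn2 k.+2) leq_addr orbT.
- exact: N_le_al.
(* Only the last element of [X] can be adjacent to the end of [s]; with nothing after the segment,
   [Y] is [X] in path order. *)
apply/subsetP => y; rewrite !inE => yX; rewrite yX /=.
apply/forall_inP => x; rewrite !inE => /andP[xX].
have -> : last h q = last w s by rewrite Es last_cat.
rewrite leqNgt; apply: contraTN => lt; apply: (X_last (y := y)) yX.
by move: lt; rewrite /= /X Es heads_cat c1 heads_seg.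
Qed.

Lemma F_w : F w = set0.
Proof.
apply/setP => x; rewrite !inE; apply/negP => /andP[xX].
by apply/negP; exact: X_w.
Qed.

Lemma off_sum : \sum_(y | y \notin s) (#|F y| + 2 * e w y) <= 2 * (#|T| - size s).-1.
Proof.
rewrite (bigD1 w) //= F_w cards0 eirr muln0 add0n.
apply: (@leq_trans (\sum_(y | (y \notin s) && (y != w)) 2)).
  apply: leq_sum => y /andP[ys yw].
  case ewy: (e w y).
    suff -> : F y = set0 by rewrite cards0.
    apply/setP => x; rewrite !inE; apply/negP => /andP[xX].
    by apply/negP; exact: X_off_w.
  rewrite muln0 addn0 (@leq_trans 1) //; apply/card_le1_eqP => x x'.
  rewrite !inE => /andP[xX ex] /andP[xX' ex']; exact: (X_off ys yw).
by rewrite sum_nat_const mulnC card_off.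
Qed.

Lemma sum_deg :
  \sum_(x in Xs) deg e x + 2 * deg e w = \sum_y (#|F y| + 2 * e w y).
Proof.
rewrite big_split /= -big_distrr /= -degE; congr addn.
under eq_bigr do rewrite degE.
rewrite exchange_big; apply: eq_bigr => y _ /=.
rewrite -sum1_card [RHS]big_mkcond [LHS]big_mkcond; apply: eq_bigr => x _.
by rewrite !inE esym; case: (x \in X); case: (e y x).
Qed.

(** One [al] is saved on the final segment and one on [w], of weight 0. The later choice of [de]
    makes the errors [de * k.-1] equal to these [2 * al]. *)
Lemma sum_deg_bound :
  (\sum_(x in Xs) deg e x + 2 * deg e w) * N + 2 * al <= al * #|T| + de * k.-1.
Proof.
have sT := size_s_lt.
have h1 := suffix_sum (s1 := [::]) erefl isT s_neq0.
have h2 := off_sum.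
rewrite sum_deg (bigID (mem s)) /= -big_uniq //= kE /=.
move: h1 h2 sT H1; move: (size s) (count _ _) (\sum_(v <- s) _) (\sum_(y | y \notin s) _).
move: #|T|; clear=> n p c A B h1 h2 h3 h4.
have : B * N <= (n - p).-1 * al.
  apply: (@leq_trans (2 * (n - p).-1 * N)); first by rewrite leq_mul2r h2 orbT.
  by rewrite [2 * _]mulnC -mulnA leq_mul2l h4 orbT.
have -> : n = p + (n - p).-1 + 1 by lia.
by have -> : (p + (n - p).-1 + 1 - p).-1 = (n - p).-1; lia.
Qed.

End LongestPath.

(** * Lower bounds on degree sums *)

Lemma independent_degree_sum (T : finType) (e : rel T) t (A : {set T}) :
  sigma2_gt e t -> {in A &, forall x y, ~~ e x y} -> 1 < #|A| ->
  #|A| * ((t - 3) * #|T|).+1 <= 2 * (t - 2) * \sum_(x in A) deg e x.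
Proof.
move=> sig ind A1; set S := \sum_(x in A) _; set M := (_ * _).+1.
(* The condition summed over the pairs containing [x]; summing over [x] then counts each degree
   [2 * (#|A| - 1)] times. *)
have row x : x \in A -> #|A|.-1 * M <= (t - 2) * ((#|A| - 2) * deg e x + S).
  move=> xA; have : \sum_(y in A :\ x) M <= \sum_(y in A :\ x) (t - 2) * (deg e x + deg e y).
    apply: leq_sum => y; rewrite in_setD1 => /andP[yx yA].
    by apply: sig; [rewrite eq_sym | exact: ind].
  have -> : S = deg e x + \sum_(y in A :\ x) deg e y.
    rewrite /S (bigD1 x) //=; congr addn; apply: eq_bigl => y.
    by rewrite in_setD1 andbC.
  rewrite -big_distrr big_split /= !sum_nat_const.
  have := cardsD1 x A; rewrite xA add1n => cA.
  have -> : #|A :\ x| = #|A|.-1 by rewrite cA.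
  have E : (#|A| - 2).+1 = #|A|.-1 by rewrite -subSn // subSS subn1.
  move=> h; apply: leq_trans h _; rewrite leq_mul2l; apply/orP; right.
  by rewrite -E mulSn -addnA addnCA.
have : \sum_(x in A) #|A|.-1 * M <=
       \sum_(x in A) (t - 2) * ((#|A| - 2) * deg e x + S).
  by apply: leq_sum => x; exact: row.
rewrite sum_nat_const -big_distrr big_split /= -big_distrr /= sum_nat_const -/S -mulnDl.
have -> : #|A| - 2 + #|A| = 2 * #|A|.-1 by move: A1; clear; lia.
move=> h; rewrite -(@leq_pmul2l #|A|.-1); last by rewrite -subn1 subn_gt0.
apply: (@leq_trans ((t - 2) * (2 * #|A|.-1 * S))); last by clear; lia.
by apply: leq_trans h; rewrite mulnCA.
Qed.

Lemma weighted_degree_sum (T : finType) (e : rel T) t (A : {set T}) w :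
  sigma2_gt e t -> {in A &, forall x y, ~~ e x y} -> 1 < #|A| ->
  (forall x, x \in A -> x != w /\ ~~ e x w) ->
  (#|A| + 2) * ((t - 3) * #|T|).+1 <=
    2 * (t - 2) * (\sum_(x in A) deg e x + 2 * deg e w).
Proof.
move=> sig ind A1 Aw; have h1 := independent_degree_sum sig ind A1.
have : \sum_(x in A) ((t - 3) * #|T|).+1 <= \sum_(x in A) (t - 2) * (deg e x + deg e w).
  by apply: leq_sum => x xA; have [xw nxw] := Aw x xA; exact: sig.
rewrite -big_distrr big_split /= !sum_nat_const => h2.
move: h1 h2 A1; move: (\sum_(x in A) _) (deg e w) (_ * #|T|).+1 #|A| (t - 2).
clear=> S W M k D h1 h2 k1.
(* The claim times [k] is [k - 2] times [h1] plus four times [h2]. *)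
rewrite -(@leq_pmul2l k); last exact: ltnW.
have [j kj] : exists j, k = j + 2 by exists (k - 2); rewrite subnK.
by subst k; have := leq_mul (leqnn j) h1; lia.
Qed.

(** * Existence lemmas, numerical bounds and conclusion *)

Lemma exists_longest_path (T : finType) (e : rel T) :
  exists s, [/\ uniq s, sorted e s &
    forall s', uniq s' -> sorted e s' -> size s' <= size s].
Proof.
pose P m := [exists s : m.-tuple T, uniq s && sorted e s].
have P0 : exists m, P m by exists 0; apply/existsP; exists [tuple].
have Pm m : P m -> m <= #|T|.
  case/existsP=> s /andP[us _]; rewrite -(size_tuple s) -(card_uniqP us).
  exact: max_card.
case: (ex_maxnP P0 Pm) => m /existsP[s /andP[us ss]] mx.
exists s; split=> // s' us' ss'; rewrite size_tuple; apply: mx.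
by apply/existsP; exists (in_tuple s'); rewrite us'.
Qed.

Lemma exists_subset_card (T : finType) (A : {set T}) n : n <= #|A| ->
  exists2 L : {set T}, L \subset A & #|L| = n.
Proof.
move=> nA; exists [set x in take n (enum A)].
  by apply/subsetP => x; rewrite inE => /mem_take; rewrite mem_enum.
rewrite cardsE; apply/eqP; move/card_uniqP: (take_uniq n (enum_uniq A)) => ->.
by rewrite size_takel // -cardE.
Qed.

Lemma weight_bounds t c : 5 <= t -> t - 2 <= c ->
  let N := 2 * (t - 2) * c in
  let al := c.+3 * (t - 3) * c in
  let de := 2 * c.+3 * (t - 3) in
  [/\ 2 * N <= al, t.-1 * N <= 2 * al & t * N <= 2 * al + de] /\
  [/\ c.+2 * N <= 3 * al, c.+1.+4 * N <= 4 * al,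
      c.+1.+3 * N <= 3 * al + de \/ (2 * t - 1) * N <= 3 * al + de & de <= 2 * N].
Proof.
move=> t5 tc /=.
have [j tj] : exists j, t = j + 5 by exists (t - 5); rewrite subnK.
have [i ci] : exists i, c = j + 3 + i by exists (c - (j + 3)); lia.
subst t c; have -> : j + 5 - 2 = j + 3 by lia.
have -> : j + 5 - 3 = j + 2 by lia.
have -> : (j + 5).-1 = j + 4 by lia.
have -> : 2 * (j + 5) - 1 = 2 * j + 9 by lia.
have mulc a b : a <= b -> a * (j + 3 + i) <= b * (j + 3 + i).
  by move=> ab; rewrite leq_mul2r ab orbT.
split; split.
- by have := mulc (4 * (j + 3)) ((j + 3 + i).+3 * (j + 2)); clear; nia.
- have := mulc ((j + 4) * (2 * (j + 3))) (2 * ((j + 3 + i).+3 * (j + 2))); clear; nia.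
- clear; nia.
- have := mulc ((j + 3 + i).+2 * (2 * (j + 3))) (3 * ((j + 3 + i).+3 * (j + 2))); clear; nia.
- have := mulc ((j + 3 + i).+1.+4 * (2 * (j + 3))) (4 * ((j + 3 + i).+3 * (j + 2))); clear; nia.
(* For [t = 5] the first alternative, based on the size of [X], holds only up to [c = 6]; for larger
   [c] the star bound gives the second. *)
- case: j {mulc t5 tc} => [|j]; last by left; nia.
  by case: (leqP i 3) => i3; [left | right]; nia.
- by clear; nia.
Qed.

Theorem theorem2 (t : nat) (T : finType) (e : rel T) :
  5 <= t -> simple_graph e -> connected_graph e -> sigma2_gt e t ->
  (exists s : seq T, hamiltonian_path e s) \/ has_induced_star e t.
Proof.
move=> t5 [esym eirr] econn sig.
have [s [us ss smax]] := exists_longest_path e.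
case: (pickP [predC s]) => [w ws|cov]; last first.
  left; exists s; split=> // [v|]; last by case: (s) ss.
  by have /negbFE := cov v.
right; rewrite inE /= in ws.
pose X := [set x in heads e w true s].
pose F v := [set x in X | e v x].
have Xind : {in X &, forall x y, ~~ e x y}.
  by move=> x y; rewrite !inE; exact: (X_indep esym eirr us ss ws smax).
have Xw x : x \in X -> x != w /\ ~~ e x w.
  rewrite inE => xX; split; last by rewrite esym (X_w esym us ss ws smax xX).
  by apply: contraNneq ws => <-; exact: (X_sub xX).
case: (boolP [exists v, t <= #|F v| + e w v]) => [/existsP[v tv]|].
  (* When adjacent to [v], [w] serves as one more leaf, since [X] and [w] together are
     independent. *)
  pose A := if e w v then w |: F v else F v.
  have tA : t <= #|A|.
    rewrite /A; case: (e w v) tv; last by rewrite addn0.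
    rewrite cardsU1 addnC; case: (boolP (w \in F v)) => // /setIdP[/Xw[]].
    by rewrite eqxx.
  have vA x : x \in A -> e v x.
    have vF : x \in F v -> e v x by case/setIdP.
    rewrite /A; case ewv: (e w v) => //.
    by rewrite in_setU1 => /orP[/eqP->|//]; rewrite esym.
  have Aw x : x \in A -> x = w \/ x \in X.
    have xF : x \in F v -> x \in X by case/setIdP.
    rewrite /A; case: (e w v); last by right; exact: xF.
    by rewrite in_setU1 => /orP[/eqP|/xF]; [left | right].
  have [L LA Lt] := exists_subset_card tA.
  exists v, L; split=> //.
  - by apply/negP => /(subsetP LA)/vA; rewrite eirr.
  - by move=> l /(subsetP LA)/vA.
  - move=> x y /(subsetP LA)/Aw[->|xX] /(subsetP LA)/Aw[->|yX].
    + by rewrite eqxx.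
    + by move=> _; rewrite esym; have [] := Xw y yX.
    + by have [] := Xw x xX.
    + by move=> _; exact: Xind.
rewrite negb_exists => /forallP cap; exfalso.
have Fcap v : #|F v| + e w v < t by rewrite ltnNge.
have ct := count_w_ge esym eirr us ss ws smax econn t5 sig.
set c := count (e w) s in ct.
have kX : #|X| = c.+1 := card_Xs esym us ss ws smax.
have c0 : 0 < c by apply: leq_trans ct; rewrite subn_gt0 (leq_trans _ t5).
have lower := weighted_degree_sum sig Xind _ Xw; rewrite kX ltnS in lower.
have [[B1 B2 B3] [B4 B5 B6 B7]] := weight_bounds t5 ct.
have := sum_deg_bound esym eirr us ss ws smax Fcap erefl B1 B2 B3 B4 B5 B6 B7
  (ltn_trans (isT : 1 < 4) t5).
move: c0 {lower}(lower c0); rewrite -/X /=.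
move: (\sum_(x in X) deg e x + _) #|T| (t - 2) (t - 3) => Q n D m.
clear=> c0 lower upper.
(* In the notation of [weight_bounds], [de * c = 2 * al], so [upper] gives [Q * N <= al * n], while
   [lower] times [c] gives [al * n + c * (c + 3) <= Q * N]. *)
by have := leq_mul lower (leqnn c); nia.
Qed.
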